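(* Among the five theta constants $\theta[\tfrac35;\tfrac k5]$, $(k=1,3,5,7,9)$, there exist at most three which are algebraically independent over $\mathbb{C}$.
   Context: Let $\mathbb{H}^2=\{\tau\in\mathbb{C}:\Im\tau>0\}$. For $(\epsilon,\epsilon')\in\mathbb{R}^2$, $$\theta[\epsilon;\epsilon'](\zeta,\tau)=\sum_{n\in\mathbb{Z}}\exp\Big(2\pi i\Big[\tfrac12\big(n+\tfrac{\epsilon}{2}\big)^2\tau+\big(n+\tfrac{\epsilon}{2}\big)\big(\zeta+\tfrac{\epsilon'}{2}\big)\Big]\Big),$$ and the theta constant $\theta[\epsilon;\epsilon']=\theta[\epsilon;\epsilon'](0,\tau)$ is regarded as a holomorphic function of $\tau\in\mathbb{H}^2$; algebraic independence is as elements of the field of meromorphic functions on $\mathbb{H}^2$. *)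

(* Defs.v *)
From HB Require Import structures.
From mathcomp Require Import all_boot all_order all_algebra.
From mathcomp Require mpoly.

(* Algebraic dependence (over K) of functions f_1..f_n : T -> K on a domain D:
   some nonzero polynomial in n variables with coefficients in K vanishes
   identically on D when evaluated at (f_1, ..., f_n).  mpoly is imported only
   inside this module, since its notations clash with mathcomp-analysis. *)
Module MP.
Import mpoly.
Local Open Scope ring_scope.
Definition alg_dependent (T : Type) (K : nzRingType) (D : T -> Prop) (n : nat)
    (f : 'I_n -> T -> K) : Prop :=
  exists p : {mpoly K[n]}, p != 0 /\ forall t, D t -> p.@[fun i => f i t] = 0.
End MP.

From mathcomp Require Import all_classical all_reals all_analysis.
From mathcomp Require Import complex.

Set Implicit Arguments.
Unset Strict Implicit.
Unset Printing Implicit Defensive.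

Import Order.TTheory GRing.Theory Num.Theory.
Import numFieldTopology.Exports numFieldNormedType.Exports.
Local Open Scope ring_scope.
Local Open Scope complex_scope.

(* Topology / norm on R[i] (the complex numbers), inherited from its
   numClosedFieldType structure (|z| = complex modulus). *)
HB.instance Definition _ (R : rcfType) := PseudoPointedMetric.copy R[i] (R[i])^o.
HB.instance Definition _ (R : rcfType) := NormedModule.copy R[i] (R[i])^o.

Section Theta.
Variable R : realType.
Local Notation C := R[i].

Definition cexp (z : C) : C :=
  (expR (complex.Re z))%:C * (cos (complex.Im z) +i* sin (complex.Im z)).

Definition upper_half (tau : C) : Prop := 0 < complex.Im tau.

Definition theta_term (e e' : R) (zeta tau : C) (n : int) : C :=
  let m : C := (n%:~R + e / 2)%:C in
  cexp ((2 * pi)%:C * 'i *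
        ((1 / 2) * m ^+ 2 * tau + m * (zeta + (e' / 2)%:C))).

(* theta[e; e'](zeta, tau) = sum over n in Z, realized as the limit of the
   symmetric partial sums sum_{-N <= n <= N} (the series converges absolutely
   for tau in the upper half plane). *)
Definition theta (e e' : R) (zeta tau : C) : C :=
  limn (fun N : nat => \sum_(i < (N.*2).+1)
          theta_term e e' zeta tau (i%:Z - N%:Z)).

Definition theta_const (e e' : R) (tau : C) : C := theta e e' 0 tau.

Definition alg_dependent_on_H (n : nat) (f : 'I_n -> C -> C) : Prop :=
  @MP.alg_dependent C C upper_half n f.

End Theta.

(* Main.v *)
Require Import Defs.
From HB Require Import structures.
From mathcomp Require Import all_boot all_order all_algebra.
From mathcomp Require Import ring lra zify.
From mathcomp Require mpoly.

(** Reindexing the double series by s = m + n and d = m - n, which have equal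
    parity, shows that theta[e; x + y] * theta[e; x - y] is a sum of two products
    U_p(x) V_p(y), p being the parity.  Hence, up to constant factors, the five
    theta constants y_i = theta[3/5; (2i + 1)/5], with i read modulo 5, satisfy
      l y_i^2 + m y_(i+2) y_(i-2) - n y_(i+1) y_(i-1) = 0    for all i
    for some (l, m, n) <> 0 which depends on tau but not on i: the point (y_i)
    lies on an elliptic normal quintic of Bianchi and Klein.  Eliminating l, m, n
    and any one of the y_i leaves a nonzero polynomial relation, homogeneous of
    degree 15, between the four other ones. *)

Set Implicit Arguments.
Unset Strict Implicit.
Unset Printing Implicit Defensive.

(** * Elimination of one variable and of the coefficients from the quadrics *)

Module Elimination.
Import mpoly GRing.Theory.
Local Open Scope ring_scope.

(** Removing [y0] from pairs of quadrics gives [l * P = m * Q] and [l * Q = n * P], so generically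
    (l : m : n) = (PQ : P^2 : Q^2). The polynomial is the relation [h12] of the next proof, which is
    free of [y0] and quadratic in l, m, n, after this substitution. *)
Definition quintic_elim (K : nzRingType) (y1 y2 y3 y4 : K) : K :=
  let P := y2 * y4 ^+ 2 - y1 ^+ 2 * y3 in
  let Q := y3 ^+ 2 * y4 - y1 * y2 ^+ 2 in
  P ^+ 3 * Q * (y1 ^+ 2 * y4) + P ^+ 4 * (y3 * y4 ^+ 2)
  + P * Q ^+ 3 * y2 ^+ 3 - Q ^+ 4 * (y1 * y2 * y3).

Lemma rmorph_quintic_elim (K L : nzRingType) (g : {rmorphism K -> L})
    (y1 y2 y3 y4 : K) :
  g (quintic_elim y1 y2 y3 y4) = quintic_elim (g y1) (g y2) (g y3) (g y4).
Proof. by rewrite /quintic_elim !(rmorphB, rmorphD, rmorphM, rmorphXn). Qed.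

Lemma quintic_elim_eq0 (K : fieldType) (l m n y0 y1 y2 y3 y4 : K) :
  (l, m, n) != 0 ->
  l * y1 ^+ 2 + m * (y3 * y4) - n * (y2 * y0) = 0 ->
  l * y2 ^+ 2 + m * (y4 * y0) - n * (y3 * y1) = 0 ->
  l * y3 ^+ 2 + m * (y0 * y1) - n * (y4 * y2) = 0 ->
  l * y4 ^+ 2 + m * (y1 * y2) - n * (y0 * y3) = 0 ->
  quintic_elim y1 y2 y3 y4 = 0.
Proof.
move=> lmn0 h1 h2 h3 h4; rewrite /quintic_elim.
set P := y2 * _ - _; set Q := y3 ^+ 2 * _ - _.
have lP : l * P = m * Q.
  apply/eqP; rewrite -subr_eq0; apply/eqP.
  transitivity (y2 * (l * y4 ^+ 2 + m * (y1 * y2) - n * (y0 * y3))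
                - y3 * (l * y1 ^+ 2 + m * (y3 * y4) - n * (y2 * y0))).
    by rewrite /P /Q; ring.
  by rewrite h1 h4 !mulr0 subr0.
have lQ : l * Q = n * P.
  apply/eqP; rewrite -subr_eq0; apply/eqP.
  transitivity (y4 * (l * y3 ^+ 2 + m * (y0 * y1) - n * (y4 * y2))
                - y1 * (l * y2 ^+ 2 + m * (y4 * y0) - n * (y3 * y1))).
    by rewrite /P /Q; ring.
  by rewrite h2 h3 !mulr0 subr0.
(* The multipliers [m * y4] and [n * y2] make the two terms in [y0] cancel. *)
have h12 : l * m * (y1 ^+ 2 * y4) + m ^+ 2 * (y3 * y4 ^+ 2)
           + l * n * y2 ^+ 3 - n ^+ 2 * (y1 * y2 * y3) = 0.
  transitivity (m * y4 * (l * y1 ^+ 2 + m * (y3 * y4) - n * (y2 * y0))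
                + n * y2 * (l * y2 ^+ 2 + m * (y4 * y0) - n * (y3 * y1))).
    by ring.
  by rewrite h1 h2 !mulr0 addr0.
set F := _ - _.
(* Each of the two factors l is absorbed by [lP] or [lQ], which turns the four terms into
   [P ^+ 2 * Q ^+ 2] times those of [h12]. *)
have lF : l ^+ 2 * F = 0.
  have -> : l ^+ 2 * F = (l * P) * (l * P ^+ 2 * Q) * (y1 ^+ 2 * y4)
      + (l * P) ^+ 2 * P ^+ 2 * (y3 * y4 ^+ 2)
      + (l * Q) * (l * (P * Q ^+ 2)) * y2 ^+ 3
      - (l * Q) ^+ 2 * Q ^+ 2 * (y1 * y2 * y3) by rewrite /F; ring.
  rewrite lP lQ -[RHS](mulr0 (P ^+ 2 * Q ^+ 2)) -h12.
  by ring.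
(* The degenerate case l = 0 has [m * Q = n * P = 0]. If both m and n are nonzero, P and Q vanish.
   If only one is, then P = 0 or Q = 0 kills all but one term of F, and a quadric reduced to a
   single monomial kills the last one. *)
have [l0|l0] := eqVneq l 0; last first.
  by move/eqP: lF; rewrite mulf_eq0 expf_eq0 /= (negPf l0) => /eqP.
have mQ : m * Q = 0 by rewrite -lP l0 mul0r.
have nP : n * P = 0 by rewrite -lQ l0 mul0r.
move: h1 h2 lmn0; rewrite l0 !mul0r !add0r => h1 h2.
have [m0|m0] := eqVneq m 0.
  have [->|n0 _] := eqVneq n 0; first by rewrite m0 eqxx.
  have P0 : P = 0 by apply/eqP; move/eqP: nP; rewrite mulf_eq0 (negPf n0).
  move/eqP: h2; rewrite m0 mul0r add0r oppr_eq0 mulf_eq0 (negPf n0) /=.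
  move=> /eqP h2.
  have -> : F = - (Q ^+ 4 * y2 * (y3 * y1)) by rewrite /F P0; ring.
  by rewrite h2 mulr0 oppr0.
have Q0 : Q = 0 by apply/eqP; move/eqP: mQ; rewrite mulf_eq0 (negPf m0).
have FE : F = P ^+ 3 * y4 * (P * (y3 * y4)) by rewrite /F Q0; ring.
move=> _; rewrite FE; have [n0|n0] := eqVneq n 0; last first.
  move/eqP: nP; rewrite mulf_eq0 (negPf n0) /= => /eqP->.
  by rewrite mul0r mulr0.
move/eqP: h1; rewrite n0 mul0r subr0 mulf_eq0 (negPf m0) /= => /eqP->.
by rewrite !mulr0.
Qed.

(** The constants [c j] leave room for the exponential factors that make the theta constants
    periodic; they are built into the polynomial. *)
Lemma alg_dependent_quintic_elim (T : Type) (K : fieldType) (D : T -> Prop)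
    (n : nat) (f : 'I_n -> T -> K) (c : 'I_n -> K) (j1 j2 j3 j4 : 'I_n) :
  (2 : K) != 0 -> (forall j, c j != 0) -> j1 \notin [:: j2; j3; j4] ->
  (forall t, D t -> quintic_elim (c j1 * f j1 t) (c j2 * f j2 t)
                                 (c j3 * f j3 t) (c j4 * f j4 t) = 0) ->
  MP.alg_dependent T K D n f.
Proof.
move=> K2 c0 j1N fE.
pose y j : {mpoly K[n]} := c j *: 'X_j.
have yE (v : 'I_n -> K) j : (y j).@[v] = c j * v j by rewrite mevalZ mevalXU.
have pE (v : 'I_n -> K) : (quintic_elim (y j1) (y j2) (y j3) (y j4)).@[v] =
   quintic_elim (c j1 * v j1) (c j2 * v j2) (c j3 * v j3) (c j4 * v j4).
  by rewrite rmorph_quintic_elim /= !yE.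
exists (quintic_elim (y j1) (y j2) (y j3) (y j4)); split; last first.
  by move=> t Dt; rewrite pE fE.
apply: contra_neq K2 => p0.
(* At the point where the first scaled variable is 0 and the three others are 1, both P and Q equal
   1 and the polynomial takes the value 2, so it is not zero. *)
have := pE (fun j => if j == j1 then 0 else (c j)^-1).
rewrite p0 meval0 eqxx mulr0.
move: j1N; rewrite !inE !negb_or => /and3P[/negPf j12 /negPf j13 /negPf j14].
rewrite ![_ == j1]eq_sym j12 j13 j14 !mulfV // => ->.
by rewrite /quintic_elim; ring.
Qed.
End Elimination.

From mathcomp Require Import all_classical all_reals all_analysis.
From mathcomp Require Import complex.
Import Order.TTheory GRing.Theory Num.Theory.
Import numFieldTopology.Exports numFieldNormedType.Exports.
Import Normc.
Local Open Scope ring_scope.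
Local Open Scope complex_scope.

(** * Symmetric sums over the integers and their convergence *)

Section Summation.
Variable R : realType.
Local Notation C := R[i].
Implicit Types (f g A B X Y : int -> C) (N : nat).

(** These are the partial sums in the definition of [theta], so that [theta] is their limit by
    conversion. The codomain is general in order to cover the real sums of norms too. *)
Definition symsum (V : zmodType) (f : int -> V) N : V :=
  \sum_(i < (N.*2).+1) f (i%:Z - N%:Z).

Lemma symsumS (V : zmodType) (f : int -> V) N :
  symsum f N.+1 = symsum f N + (f N.+1%:Z + f (- N.+1%:Z)).
Proof.
rewrite /symsum doubleS big_ord_recl big_ord_recr /= sub0r.
rewrite [LHS]addrC -[LHS]addrA.
congr (_ + (f _ + _)); last by rewrite /bump; lia.
by apply: eq_bigr => i _; congr f; rewrite /bump /=; lia.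
Qed.

Lemma symsum0 (V : zmodType) (f : int -> V) : symsum f 0 = f 0.
Proof. by rewrite /symsum big_ord1 subr0. Qed.

Lemma norm_normc (z : C) : `|z| = (normc z)%:C.
Proof. by rewrite normc_def; case: z. Qed.

Lemma norm_Re_le (z : C) : `|complex.Re z| <= normc z.
Proof.
by case: z => a b /=; rewrite -sqrtr_sqr ler_wsqrtr // lerDl sqr_ge0.
Qed.

Lemma norm_Im_le (z : C) : `|complex.Im z| <= normc z.
Proof.
by case: z => a b /=; rewrite -sqrtr_sqr ler_wsqrtr // lerDr sqr_ge0.
Qed.

Lemma normc_le_ReIm (z : C) : normc z <= `|complex.Re z| + `|complex.Im z|.
Proof.
case: z => a b /=.
rewrite -[leRHS]ger0_norm ?addr_ge0 // -sqrtr_sqr ler_wsqrtr //.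
rewrite sqrrD !real_normK ?num_real //.
by have := mulr_ge0 (normr_ge0 a) (normr_ge0 b); lra.
Qed.

Lemma cvg_complex (u : nat -> C) (a b : R) :
  (complex.Re (u n) @[n --> \oo] --> a)%classic ->
  (complex.Im (u n) @[n --> \oo] --> b)%classic ->
  (u n @[n --> \oo] --> (a +i* b : C))%classic.
Proof.
move=> ua ub; apply/cvgrPdist_lt => e e0.
(* A positive element of [R[i]] is real: the order compares only numbers with the same imaginary
   part. *)
have eE : e = (complex.Re e)%:C.
  by move: e0; case: e => x y; rewrite ltcE /= => /andP[/eqP-> _].
have re0 : 0 < complex.Re e / 2.
  by rewrite divr_gt0 //; move: e0; rewrite ltcE => /andP[].
near=> n.
have ha : `|a - complex.Re (u n)| < complex.Re e / 2.
  by near: n; move/cvgrPdist_lt: ua; exact.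
have hb : `|b - complex.Im (u n)| < complex.Re e / 2.
  by near: n; move/cvgrPdist_lt: ub; exact.
rewrite norm_normc eE ltcR (le_lt_trans (normc_le_ReIm _)) //.
rewrite (splitr (complex.Re e)); apply: ltrD.
  by move: ha; case: (u n).
by move: hb; case: (u n).
Unshelve. all: by end_near.
Qed.

Lemma is_cvg_sum_geometric (u v : nat -> R) (c r : R) : 0 <= r < 1 ->
  (forall n, u n.+1 = u n + v n) -> (forall n, `|v n| <= c * r ^+ n) -> cvgn u.
Proof.
move=> /andP[r0 r1] uS vle.
have cv : cvgn (series v).
  apply: normed_cvg; apply: (@series_le_cvg _ _ (geometric c r)) => //=.
  - by move=> n; exact: le_trans (vle n).
  - by apply: is_cvg_geometric_series; rewrite ger0_norm.
have uE : u = (fun n => u 0%N + series v n).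
  apply/funext; elim=> [|n IH]; first by rewrite /series /= big_nil addr0.
  by rewrite uS IH /series /= big_nat_recr //= addrA.
by rewrite uE; apply: is_cvgD => //; exact: is_cvg_cst.
Qed.

(** A concrete form of absolute convergence, inherited by the even and odd parts of a series. *)
Definition geom_bounded f :=
  exists c r : R, 0 <= r < 1 /\ forall n, normc (f n) <= c * r ^+ `|n|%N.

Lemma symsum_is_cvg f : geom_bounded f -> cvgn (symsum f).
Proof.
move=> [c [r [r01 fle]]].
have tle n : normc (f n.+1%:Z + f (- n.+1%:Z)) <= (2 * c * r) * r ^+ n.
  apply: le_trans (le_normcD _ _) _.
  have := lerD (fle n.+1%:Z) (fle (- n.+1%:Z)).
  rewrite abszN absz_nat exprS => /le_trans; apply; lra.
have cR : cvgn (fun n => complex.Re (symsum f n)).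
  apply: (@is_cvg_sum_geometric _
    (fun n => complex.Re (f n.+1%:Z + f (- n.+1%:Z))) _ _ r01).
    by move=> n; rewrite symsumS raddfD.
  by move=> n; apply: le_trans (tle n); exact: norm_Re_le.
have cI : cvgn (fun n => complex.Im (symsum f n)).
  apply: (@is_cvg_sum_geometric _
    (fun n => complex.Im (f n.+1%:Z + f (- n.+1%:Z))) _ _ r01).
    by move=> n; rewrite symsumS raddfD.
  by move=> n; apply: le_trans (tle n); exact: norm_Im_le.
by apply/cvg_ex; eexists; apply: cvg_complex; [exact: cR|exact: cI].
Qed.

Lemma normc_nneg (z : C) : 0 <= normc z.
Proof. by case: z => a b; exact: sqrtr_ge0. Qed.

Lemma symsum_norm_is_cvg f : geom_bounded f ->
  cvgn (symsum (fun n => normc (f n))).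
Proof.
move=> [c [r [r01 fle]]].
apply: (@is_cvg_sum_geometric _
  (fun n => normc (f n.+1%:Z) + normc (f (- n.+1%:Z))) (2 * c * r) _ r01).
  by move=> n; rewrite symsumS.
move=> n; have := lerD (fle n.+1%:Z) (fle (- n.+1%:Z)).
rewrite abszN absz_nat exprS ger0_norm ?addr_ge0 ?normc_nneg //.
by move=> /le_trans; apply; lra.
Qed.

(** * Rearrangement of a product of two series by parity *)

Lemma symsum_cut (V : zmodType) (f : int -> V) N M : (N <= M)%N ->
  symsum (fun n => if (`|n| <= N)%N then f n else 0) M = symsum f N.
Proof.
elim: M => [|M IH]; first by rewrite leqn0 => /eqP->; rewrite !symsum0.
rewrite leq_eqVlt => /orP[/eqP<-|NM].
  by apply: eq_bigr => i _; rewrite ifT //; have := ltn_ord i; lia.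
by rewrite symsumS IH // !ifF ?addr0 //; lia.
Qed.

Lemma symsumM (f g : int -> C) N M :
  symsum f N * symsum g M = symsum (fun m => symsum (fun n => f m * g n) M) N.
Proof.
by rewrite /symsum mulr_suml; apply: eq_bigr => i _; rewrite mulr_sumr.
Qed.

Definition parity (p : bool) f (n : int) : C :=
  if odd `|n| == p then f n else 0.

(* (s, d) = (m + n, m - n) maps the lattice points with |m| + |n| <= 2N onto the
   pairs of equal parity in the square [-2N, 2N]^2. *)
Lemma symsum_diamond (X Y : int -> C) N :
  symsum (parity false X) N.*2 * symsum (parity false Y) N.*2 +
  symsum (parity true X) N.*2 * symsum (parity true Y) N.*2 =
  symsum (fun m => symsum (fun n =>
    if (`|m| + `|n| <= N.*2)%N then X (m + n) * Y (m - n) else 0) N.*2) N.*2.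
Proof.
pose K := (N.*2.*2).+1.
rewrite !symsumM /symsum -big_split /=.
transitivity (\sum_(i < K) \sum_(j < K | odd i == odd j)
    X (i%:Z - N.*2%:Z) * Y (j%:Z - N.*2%:Z)).
  apply: eq_bigr => i _; rewrite -big_split [RHS]big_mkcond /=.
  apply: eq_bigr => j _; rewrite /parity.
  have -> : odd `|i%:Z - N.*2%:Z| = odd i by lia.
  have -> : odd `|j%:Z - N.*2%:Z| = odd j by lia.
  by case: (odd i); case: (odd j); rewrite ?mulr0 ?mul0r ?addr0 ?add0r.
rewrite [RHS](eq_bigr (fun i : 'I_K => \sum_(j < K |
    (`|i%:Z - N.*2%:Z| + `|j%:Z - N.*2%:Z| <= N.*2)%N)
    X (i%:Z - N.*2%:Z + (j%:Z - N.*2%:Z)) *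
    Y (i%:Z - N.*2%:Z - (j%:Z - N.*2%:Z))));
  last by move=> i _; rewrite -big_mkcond.
rewrite !pair_big_dep /=.
(* The index i stands for the integer i - 2N; with these offsets [h] is (m, n) -> (m + n, m - n),
   and [h'] is its inverse on pairs of equal parity. Outside the diamond, where truncation by
   [inord] or by subtraction may occur, the conditions of the reindexing fail. *)
pose h (p : 'I_K * 'I_K) : 'I_K * 'I_K :=
  (inord (p.1 + p.2 - N.*2), inord (p.1 + N.*2 - p.2)).
pose h' (p : 'I_K * 'I_K) : 'I_K * 'I_K :=
  (inord (p.1 + p.2)./2, inord (p.1 + N.*2.*2 - p.2)./2).
rewrite (reindex_onto h h') /=; last first.
  case=> [[i ltiK] [j ltjK]] /= /eqP ij; rewrite /h /h' /= /K in ltiK ltjK *.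
  congr pair; apply/val_inj; rewrite /= !inordK; lia.
have hP (p : 'I_K * 'I_K) : odd (h p).1 == odd (h p).2 -> h' (h p) = p ->
    (h p).1%:Z - N.*2%:Z = p.1%:Z - N.*2%:Z + (p.2%:Z - N.*2%:Z) /\
    (h p).2%:Z - N.*2%:Z = p.1%:Z - N.*2%:Z - (p.2%:Z - N.*2%:Z).
  case: (h p) => [[a lta] [b ltb]] /= /eqP ab; rewrite /h' /= => hp.
  have := congr1 (fun q => nat_of_ord q.1) hp.
  have := congr1 (fun q => nat_of_ord q.2) hp.
  by rewrite /= !inordK; rewrite /K in lta ltb *; lia.
apply: eq_big => [p|p /andP[ab /eqP hp]]; last by have [-> ->] := hP p ab hp.
apply/andP/idP => [[ab /eqP hp]|dia].
  have [] := hP p ab hp; have := ltn_ord (h p).1; have := ltn_ord (h p).2.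
  by rewrite /K; lia.
have [] := (ltn_ord p.1, ltn_ord p.2); rewrite {1 3}/K => lt1 lt2.
have h1 : (h p).1 = (p.1 + p.2 - N.*2)%N :> nat by rewrite /h inordK //=; lia.
have h2 : (h p).2 = (p.1 + N.*2 - p.2)%N :> nat by rewrite /h inordK //=; lia.
split; first by rewrite h1 h2; lia.
rewrite /h' h1 h2; apply/eqP; case: p dia lt1 lt2 {h1 h2} => i j /= dia lt1 lt2.
by congr pair; apply/val_inj; rewrite /= inordK; lia.
Qed.


Lemma cvg_doublen : (n.*2 @[n --> \oo] --> \oo)%classic.
Proof.
move=> A [N _ NA]; exists N => //= n /= Nn; apply: NA => /=.
by rewrite -addnn (leq_trans Nn) // leq_addr.
Qed.

Lemma cvg_double (T : topologicalType) (u : nat -> T) (l : T) :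
  (u n @[n --> \oo] --> l)%classic -> (u n.*2 @[n --> \oo] --> l)%classic.
Proof. by move=> ul; exact: (cvg_comp _ _ cvg_doublen ul). Qed.

Lemma normc_sum (I : finType) (P : pred I) (F : I -> C) :
  normc (\sum_(i | P i) F i) <= \sum_(i | P i) normc (F i).
Proof.
elim/big_rec2: _ => [|i x y _ le_yx]; first by rewrite normc0.
by apply: le_trans (le_normcD _ _) _; rewrite lerD2l.
Qed.

(** The diamond |m| + |n| <= 2N contains the square of radius N and lies in the square of radius 2N.
    The terms in excess of the small square are thus bounded by the products of norms between the
    two squares. *)
Lemma diamond_dist A B N :
  normc (symsum (fun m => symsum (fun n =>
           if (`|m| + `|n| <= N.*2)%N then A m * B n else 0) N.*2) N.*2
         - symsum A N * symsum B N) <=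
  symsum (fun n => normc (A n)) N.*2 * symsum (fun n => normc (B n)) N.*2
  - symsum (fun n => normc (A n)) N * symsum (fun n => normc (B n)) N.
Proof.
have NN : (N <= N.*2)%N by lia.
rewrite -(symsum_cut A NN) -(symsum_cut B NN).
rewrite -(symsum_cut (fun n => normc (A n)) NN).
rewrite -(symsum_cut (fun n => normc (B n)) NN).
rewrite /symsum !mulr_suml -!sumrB.
apply: le_trans (normc_sum _ _) _; apply: ler_sum => i _.
rewrite !mulr_sumr -!sumrB.
apply: le_trans (normc_sum _ _) _; apply: ler_sum => j _.
set m := i%:Z - _; set n := j%:Z - _.
have ge0 : 0 <= normc (A m) * normc (B n) by rewrite mulr_ge0 ?normc_nneg.
case: ifP => mn; case: ifP => hm; case: ifP => hn;
  rewrite ?mulr0 ?mul0r ?subr0 ?subrr ?normc0 ?normcM //.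
by lia.
Qed.

Lemma geom_bounded_parity p f : geom_bounded f -> geom_bounded (parity p f).
Proof.
move=> [c [r [r01 fle]]]; exists c, r; split=> // n; rewrite /parity.
by case: ifP => // _; rewrite normc0 (le_trans _ (fle n)) ?normc_nneg.
Qed.

(** The sum over the diamond differs from the product of partial sums of A and B by at most the
    increment, from N to 2N, of the product of the sums of norms. This increment tends to 0 because
    the sums of norms converge. *)
Lemma limn_symsum_mul A B X Y :
  geom_bounded A -> geom_bounded B -> geom_bounded X -> geom_bounded Y ->
  (forall m n, A m * B n = X (m + n) * Y (m - n)) ->
  limn (symsum A) * limn (symsum B) =
  limn (symsum (parity false X)) * limn (symsum (parity false Y)) +
  limn (symsum (parity true X)) * limn (symsum (parity true Y)).
Proof.
move=> Ale Ble Xle Yle ABXY.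
have cX p := cvg_double (symsum_is_cvg (geom_bounded_parity p Xle)).
have cY p := cvg_double (symsum_is_cvg (geom_bounded_parity p Yle)).
have cA := symsum_is_cvg Ale; have cB := symsum_is_cvg Ble.
have cnA := symsum_norm_is_cvg Ale; have cnB := symsum_norm_is_cvg Ble.
pose D n := symsum (parity false X) n.*2 * symsum (parity false Y) n.*2 +
  symsum (parity true X) n.*2 * symsum (parity true Y) n.*2.
have cE : (D n - symsum A n * symsum B n @[n --> \oo] -->
    limn (symsum (parity false X)) * limn (symsum (parity false Y)) +
    limn (symsum (parity true X)) * limn (symsum (parity true Y)) -
    limn (symsum A) * limn (symsum B))%classic.
  have cM (u v : nat -> C) (a b : C) : (u n @[n --> \oo] --> a)%classic ->
      (v n @[n --> \oo] --> b)%classic ->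
      (u n * v n @[n --> \oo] --> a * b)%classic.
    by move=> ua vb; exact: (cvgM ua vb).
  have cf := cM _ _ _ _ (cX false) (cY false).
  have ct := cM _ _ _ _ (cX true) (cY true).
  have cD : (D n @[n --> \oo] -->
      limn (symsum (parity false X)) * limn (symsum (parity false Y)) +
      limn (symsum (parity true X)) * limn (symsum (parity true Y)))%classic.
    exact: (cvgD cf ct).
  have cAB := cM _ _ _ _ cA cB.
  exact: (cvgB cD cAB).
apply/eqP; rewrite eq_sym -subr_eq0; apply/eqP.
pose nA := symsum (fun n => normc (A n)).
pose nB := symsum (fun n => normc (B n)).
have nE0 : (normc (D n - symsum A n * symsum B n)
    @[n --> \oo] --> (0 : R))%classic.
  apply: (@squeeze_cvgr _ _ _ _ (fun=> 0)
    (fun n => nA n.*2 * nB n.*2 - nA n * nB n)).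
  - near=> n; rewrite normc_nneg /= /D symsum_diamond.
    apply: le_trans (diamond_dist A B n).
    rewrite le_eqVlt; apply/orP; left; apply/eqP.
    congr (normc (_ - _)); apply: eq_bigr => i _; apply: eq_bigr => j _.
    by rewrite ABXY.
  - exact: cvg_cst.
  - rewrite -(subrr (limn nA * limn nB)); apply: cvgB; apply: cvgM => //.
      exact: cvg_double.
    exact: cvg_double.
suff c0 : (D n - symsum A n * symsum B n @[n --> \oo] --> (0 : C))%classic.
  exact: (@cvg_unique C (@norm_hausdorff _ C) _ _ _ _ cE c0).
apply/cvgr0Pnorm_lt => e e0.
have re0 : 0 < complex.Re e by move: e0; rewrite ltcE => /andP[].
have eE : e = (complex.Re e)%:C.
  by move: e0; case: e {re0} => x y; rewrite ltcE /= => /andP[/eqP-> _].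
near=> n; rewrite eE norm_normc ltcR -[ltLHS]ger0_norm ?normc_nneg //.
by near: n; move/cvgr0Pnorm_lt: nE0; exact.
Unshelve. all: by end_near.
Qed.

End Summation.

(** * Product formula and periodicity of the theta constants *)

Section ThetaSeries.
Variable R : realType.
Local Notation C := R[i].
Implicit Types (e d t : R) (tau : C).

Lemma cexpD (z w : C) : cexp (z + w) = cexp z * cexp w.
Proof.
case: z w => [a b] [c d]; rewrite /cexp /= expRD cosD sinD.
by apply/eqP; rewrite eq_complex /=; apply/andP; split; apply/eqP; ring.
Qed.

Lemma cexp0 : cexp (0 : C) = 1.
Proof. by rewrite /cexp /= expR0 cos0 sin0 mul1r. Qed.

Lemma cexp_neq0 (z : C) : cexp z != 0.
Proof.
apply/eqP => z0; have := cexpD z (- z); rewrite subrr cexp0 z0 mul0r.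
by move/eqP; rewrite oner_eq0.
Qed.

Lemma normc_cexp (z : C) : normc (cexp z) = expR (complex.Re z).
Proof.
rewrite /cexp normcM /= expr0n addr0 sqrtr_sqr ger0_norm ?expR_ge0 //.
by rewrite cos2Dsin2 sqrtr1 mulr1.
Qed.

Lemma cexp_2pii_nat (n : nat) : cexp ((2 * pi)%:C * 'i * (n%:R)%:C : C) = 1.
Proof.
elim: n => [|n IH]; first by rewrite mulr0 cexp0.
rewrite -(natr1 n) rmorphD /= mulrDr cexpD IH mul1r mulr1 /cexp /=.
rewrite !(mulr0, mul0r, mulr1, subr0, sub0r, addr0, add0r, oppr0) expR0 mul1r.
by rewrite mulr_natl cos2pi sin2pi.
Qed.

Lemma cexp_2pii_int (n : int) : cexp ((2 * pi)%:C * 'i * (n%:~R)%:C : C) = 1.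
Proof.
case: n => n; first exact: cexp_2pii_nat.
rewrite NegzE mulrNz rmorphN /= mulrN.
set z := (2 * pi)%:C * 'i * _; have := cexpD z (- z); rewrite /z.
by rewrite subrr cexp0 cexp_2pii_nat mul1r.
Qed.

Lemma theta_const_symsum e d tau :
  theta_const e d tau = limn (symsum (theta_term e d 0 tau)).
Proof. by []. Qed.

Lemma theta_termE e d tau n : let m := n%:~R + e / 2 in
  theta_term e d 0 tau n = cexp (- (pi * complex.Im tau * m ^+ 2) +i*
                                 (pi * complex.Re tau * m ^+ 2 + pi * m * d)).
Proof.
move=> m; rewrite /theta_term -/m; congr cexp; case: tau => a b.
have -> : (1 / 2 : C) = (2^-1 : R)%:C by rewrite mul1r fmorphV rmorph_nat.
rewrite add0r !expr2.
by apply/eqP; rewrite eq_complex /=; apply/andP; split; apply/eqP; field.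
Qed.

Lemma theta_term_le e d tau : upper_half tau ->
  geom_bounded (theta_term e d 0 tau).
Proof.
rewrite /upper_half => tau0; set b := complex.Im tau in tau0.
have b0 : 0 < pi * b by rewrite mulr_gt0 ?pi_gt0.
exists (expR (pi * b * (`|e / 2| + 1))), (expR (- (pi * b))).
split; first by rewrite expR_ge0 expR_lt1 oppr_lt0.
move=> n; rewrite theta_termE normc_cexp /= -expRM_natl -expRD ler_expR -/b.
set x := n%:~R; set a := e / 2.
have nx : `|n|%N%:R = `|x| :> R by rewrite natr_absz intr_norm.
(* A linear lower bound of the square turns the Gaussian decay into a geometric one; it follows from
   (|x + a| - 1/2)^2 >= 0. *)
have : `|x| - `|a| - 1 <= (x + a) ^+ 2.
  have h : `|x| <= `|x + a| + `|a|.
    by rewrite -{1}(addrK a x) (le_trans (ler_normB _ _)).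
  have h2 := sqr_ge0 (`|x + a| - 2^-1).
  rewrite -(real_normK (num_real (x + a))).
  move: h h2; move: `|x + a| => y; move: `|x| `|a| => u v.
  rewrite sqrrB; lra.
rewrite nx; move: b0; move: (pi * b) `|x| `|a| ((x + a) ^+ 2) => p u v w p0 uvw.
nra.
Qed.

Lemma half_complex (z : C) : z / 2 = (complex.Re z / 2) +i* (complex.Im z / 2).
Proof.
case: z => a b; have -> : (2^-1 : C) = (2^-1 : R)%:C.
  by rewrite fmorphV rmorph_nat.
by apply/eqP; rewrite eq_complex /= !mulr0 subr0 add0r !eqxx.
Qed.

(** With M = m + e/2 and N = n + e/2, this is M^2 + N^2 = ((M + N)^2 + (M - N)^2) / 2 together with
    M (d1 + d2) + N (d1 - d2) = (M + N) d1 + (M - N) d2. The half-shifts add up in M + N, whence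
    [2 * e], and cancel in M - N, whence 0. *)
Lemma theta_term_mul e d1 d2 tau m n :
  theta_term e (d1 + d2) 0 tau m * theta_term e (d1 - d2) 0 tau n =
  theta_term (2 * e) d1 0 (tau / 2) (m + n) *
  theta_term 0 d2 0 (tau / 2) (m - n).
Proof.
rewrite !theta_termE -!cexpD; congr cexp.
rewrite half_complex intrD intrB.
by apply/eqP; rewrite eq_complex /=; apply/andP; split; apply/eqP; field.
Qed.

Lemma theta_const_bilinear e tau : upper_half tau ->
  exists (U : R -> bool -> C) (V : R -> bool -> C), forall d1 d2,
    theta_const e (d1 + d2) tau * theta_const e (d1 - d2) tau =
    U d1 false * V d2 false + U d1 true * V d2 true.
Proof.
move=> tau0; have tau20 : upper_half (tau / 2).
  by rewrite /upper_half half_complex divr_gt0.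
exists (fun d p => limn (symsum (parity p (theta_term (2 * e) d 0 (tau / 2))))).
exists (fun d p => limn (symsum (parity p (theta_term 0 d 0 (tau / 2))))).
move=> d1 d2; rewrite !theta_const_symsum.
apply: limn_symsum_mul; try exact: theta_term_le.
exact: theta_term_mul.
Qed.

(* The factor makes theta_per 2-periodic in d. *)
Definition theta_per e d tau : C :=
  cexp (0 +i* - (pi * e * d / 2)) * theta_const e d tau.

Lemma theta_const_add2 e d tau : upper_half tau ->
  theta_const e (d + 2) tau = cexp (0 +i* (pi * e)) * theta_const e d tau.
Proof.
move=> tau0; rewrite !theta_const_symsum.
have -> : symsum (theta_term e (d + 2) 0 tau) =
    (fun N => cexp (0 +i* (pi * e)) * symsum (theta_term e d 0 tau) N).
  apply/funext => N; rewrite /symsum mulr_sumr; apply: eq_bigr => i _.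
  (* Adding 2 to d adds 2 pi n + pi e to the argument of the n-th term; the part 2 pi n is invisible
     to [cexp]. *)
  rewrite -[RHS]mul1r -(cexp_2pii_int (i%:Z - N%:Z)) !theta_termE.
  rewrite -!cexpD; congr cexp.
  by apply/eqP; rewrite eq_complex /=; apply/andP; split; apply/eqP; field.
have cu := symsum_is_cvg (theta_term_le e d tau0).
have cc : ((fun=> cexp (0 +i* (pi * e))) n @[n --> \oo] -->
    cexp (0 +i* (pi * e)))%classic.
  exact: cvg_cst.
apply: (@cvg_lim C (@norm_hausdorff _ C)).
exact: (cvgM cc cu).
Qed.

Lemma theta_per_add2 e d tau : upper_half tau ->
  theta_per e (d + 2) tau = theta_per e d tau.
Proof.
move=> tau0; rewrite /theta_per theta_const_add2 // mulrA -cexpD.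
congr (cexp _ * _).
by apply/eqP; rewrite eq_complex /=; apply/andP; split; apply/eqP; field.
Qed.

(** The periodicity factors at d1 + d2 and d1 - d2 multiply to an exponential in d1 alone, which is
    absorbed into U. *)
Lemma theta_per_bilinear e tau : upper_half tau ->
  exists (U : R -> bool -> C) (V : R -> bool -> C), forall d1 d2,
    theta_per e (d1 + d2) tau * theta_per e (d1 - d2) tau =
    U d1 false * V d2 false + U d1 true * V d2 true.
Proof.
move=> tau0; have [U [V UV]] := theta_const_bilinear e tau0.
exists (fun d p => cexp (0 +i* - (pi * e * d)) * U d p), V => d1 d2.
transitivity (cexp (0 +i* - (pi * e * d1)) *
  (U d1 false * V d2 false + U d1 true * V d2 true)); last by ring.
rewrite -UV /theta_per mulrACA -cexpD; congr (cexp _ * _).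
by apply/eqP; rewrite eq_complex /=; apply/andP; split; apply/eqP; field.
Qed.

(** * Quadrics through the theta constants, and their elimination *)

Lemma planar_dependent (K : fieldType) (a b c : bool -> K) :
  exists l m n : K, (l, m, n) != 0 /\ forall p, l * a p + m * b p - n * c p = 0.
Proof.
pose V : 'M[K]_(3, 2) := \matrix_(i, j) nth a [:: a; b; c] i (j == 1 :> nat).
have : kermx V != 0.
  by rewrite kermx_eq0 /row_free ltn_eqF // (leq_ltn_trans (rank_leq_col V)).
case/rowV0Pn => w /sub_kermxP wV w0.
exists (w 0 ord0), (w 0 (lift ord0 ord0)).
exists (- w 0 (lift ord0 (lift ord0 ord0))); split.
  apply: contra w0 => /eqP[w00 w01 w02]; apply/eqP/rowP => i; rewrite mxE.
  have w02' : w 0 (lift ord0 (lift ord0 ord0)) = 0.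
    by apply/eqP; rewrite -oppr_eq0; apply/eqP.
  by case: i => [[|[|[|]]] // lti];
     [rewrite -[RHS]w00|rewrite -[RHS]w01|rewrite -[RHS]w02'];
     congr (w _ _); apply/val_inj.
move=> p; have /rowP/(_ (if p then 1 else 0)) := wV.
rewrite !mxE !big_ord_recl big_ord0 !mxE /=.
by case: p; rewrite addr0 mulNr opprK addrA => <-.
Qed.

(** The shifts 0, 2t and t give three vectors V in a plane. A linear relation between them involves
    no d, so it holds with the same coefficients after pairing with U d for every d. *)
Lemma theta_per_quadrics e t tau : upper_half tau ->
  exists l m n : C, (l, m, n) != 0 /\ forall d,
    l * theta_per e d tau ^+ 2
    + m * (theta_per e (d + t *+ 2) tau * theta_per e (d - t *+ 2) tau)
    - n * (theta_per e (d + t) tau * theta_per e (d - t) tau) = 0.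
Proof.
move=> tau0; have [U [V UV]] := theta_per_bilinear e tau0.
have [l [m [n [lmn0 lmn]]]] := planar_dependent (V 0) (V (t *+ 2)) (V t).
exists l, m, n; split=> // d.
have := UV d 0; rewrite addr0 subr0 -expr2 => ->; rewrite !UV.
transitivity (U d false * (l * V 0 false + m * V (t *+ 2) false - n * V t false)
  + U d true * (l * V 0 true + m * V (t *+ 2) true - n * V t true)).
  by ring.
by rewrite !lmn !mulr0 addr0.
Qed.

Lemma theta_per_quintic_elim e t d tau : upper_half tau -> t *+ 5 = 2 ->
  Elimination.quintic_elim
    (theta_per e (d + t) tau) (theta_per e (d + t *+ 2) tau)
    (theta_per e (d + t *+ 3) tau) (theta_per e (d + t *+ 4) tau) = 0.
Proof.
move=> tau0 t5; have [l [m [n [lmn0 lmn]]]] := theta_per_quadrics e t tau0.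
pose y i := theta_per e (d + t *+ i) tau.
have y5 i : y (i + 5)%N = y i by rewrite /y mulrnDr addrA t5 theta_per_add2.
have row i : l * y (i + 2)%N ^+ 2 + m * (y (i + 4)%N * y i)
             - n * (y (i + 3)%N * y (i + 1)%N) = 0.
  have up2 : d + t *+ (i + 2) + t *+ 2 = d + t *+ (i + 4).
    by rewrite -addrA -mulrnDr -addnA.
  have down2 : d + t *+ (i + 2) - t *+ 2 = d + t *+ i.
    by rewrite mulrnDr addrA addrK.
  have up1 : d + t *+ (i + 2) + t = d + t *+ (i + 3).
    by rewrite -addrA -mulrSr -addnS.
  have down1 : d + t *+ (i + 2) - t = d + t *+ (i + 1).
    by rewrite (addnS i 1) mulrSr addrA addrK.
  by have := lmn (d + t *+ (i + 2)); rewrite up2 down2 up1 down1.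
(* Modulo 5 these are the quadrics centred at [y 1], [y 2], [y 3] and [y 4], in the order expected
   by the elimination. *)
have := (row 4%N, row 0%N, row 1%N, row 2%N).
rewrite /= (y5 0%N) (y5 1%N) (y5 2%N) (y5 3%N) => -[[[row1 row2] row3] row4].
by have := Elimination.quintic_elim_eq0 lmn0 row1 row2 row3 row4.
Qed.

End ThetaSeries.

(** * Application to four of the five theta constants *)

Lemma codom_inj_ord (n : nat) (a : 'I_n -> 'I_n.+1) : injective a ->
  exists m, forall x, x != m -> x \in codom a.
Proof.
move=> inja; have ca : #|codom a| = n by rewrite card_codom // card_ord.
have : #|[predC codom a]| = 1%N.
  by apply/eqP; rewrite -(eqn_add2l #|codom a|) cardC ca card_ord addn1.
by move/mem_card1 => [m mE]; exists m => x xm; have := mE x; rewrite !inE (negPf xm) => /negbFE.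
Qed.

(* Among theta[3/5; k/5], k = 1,3,5,7,9, at most three are algebraically
   independent: any four of them (with distinct indices) are algebraically
   dependent over C. *)
Theorem theorem7p3 (R : realType) (k : 'I_4 -> nat) :
  injective k ->
  (forall j, k j \in [:: 1; 3; 5; 7; 9]%N) ->
  alg_dependent_on_H
    (fun j (tau : R[i]) => theta_const (3 / 5) ((k j)%:R / 5) tau).
Proof.
move=> injk k_odd.
pose a j : 'I_5 := inord (k j)./2.
have aE j : k j = (a j).*2.+1.
  rewrite /a inordK; have := k_odd j; rewrite !inE; lia.
have [i1 i2 /(congr1 val) a12|m mP] := @codom_inj_ord 4 a.
  by apply: injk; rewrite !aE a12.
(* The constant of index m is the one absent from the four given ones and takes the place of [y0];
   the given ones sit 1, 2, 3 and 4 places after it modulo 5. *)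
have jP (r : nat) : (0 < r < 5)%N -> exists j, a j = ((m + r) %% 5)%N :> nat.
  move=> r05; have /codomP[j jE] : inord ((m + r) %% 5)%N \in codom a.
    apply: mP; rewrite -val_eqE /= inordK ?ltn_pmod //.
    by have := ltn_ord m; apply: contraTneq; lia.
  by exists j; rewrite -jE inordK // ltn_pmod.
have [j1 j1E] := jP 1%N isT; have [j2 j2E] := jP 2%N isT.
have [j3 j3E] := jP 3%N isT; have [j4 j4E] := jP 4%N isT.
pose c j : R[i] := cexp (0 +i* - (pi * (3 / 5) * ((k j)%:R / 5) / 2)).
apply: (@Elimination.alg_dependent_quintic_elim _ _ _ _ _ c j1 j2 j3 j4).
- by rewrite pnatr_eq0.
- by move=> j; exact: cexp_neq0.
- have am := ltn_ord m; rewrite !inE !negb_or.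
  apply/and3P; split; apply/eqP => j12; move: j1E;
    by rewrite j12 ?j2E ?j3E ?j4E; lia.
move=> tau tau0.
have fE j r : (r < 5)%N -> a j = ((m + r) %% 5)%N :> nat ->
    c j * theta_const (3 / 5) ((k j)%:R / 5) tau =
    theta_per (3 / 5) ((m.*2.+1)%:R / 5 + (2 / 5) *+ r) tau.
  move=> r5 jE; rewrite -[LHS]/(theta_per _ _ _) aE jE.
  (* When m + r wraps around modulo 5, the characteristic drops by 2, which [theta_per] does not
     see. *)
  have [mr|mr] := ltnP (m + r)%N 5.
    rewrite modn_small //.
    suff -> : ((m + r).*2.+1)%:R / 5 =
        (m.*2.+1)%:R / 5 + (2 / 5) *+ r :> R by [].
    by rewrite -!natr1 -!mul2n !natrM natrD -mulr_natr; field.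
  have m5 := ltn_ord m; have -> : ((m + r) %% 5 = m + r - 5)%N by lia.
  rewrite -theta_per_add2 //.
  suff -> : ((m + r - 5).*2.+1)%:R / 5 + 2 =
      (m.*2.+1)%:R / 5 + (2 / 5) *+ r :> R.
    by [].
  by rewrite -!natr1 -!mul2n !natrM natrB // natrD -mulr_natr; field.
rewrite (fE j1 1%N) // (fE j2 2%N) // (fE j3 3%N) // (fE j4 4%N) //.
by apply: theta_per_quintic_elim => //; rewrite -mulr_natr; field.
Qed.
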